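(* Let $n\ge1$, let $w\in\mathbb{R}^n$ with $w_1\ge\cdots\ge w_n\ge 0$, and let $v\in\mathbb{R}^n$. Let $P(v)$ be a permutation matrix such that $\grave{v}=P(v)v$ satisfies $|\grave{v}_i|\ge|\grave{v}_{i+1}|$ for $i=1,\dots,n-1$. Let $\{s_1,\dots,t_1\},\dots,\{s_l,\dots,t_l\}$ be the groups of consecutive indices associated with $(|\grave{v}|,w)$, and let $\bar{\bar v},\bar{\bar w}\in\mathbb{R}^n$ be the corresponding group-averaged vectors (all as defined in the context). Put $$b=\max(\bar{\bar v}-\bar{\bar w},\,0)\ \text{(componentwise)},\qquad a=P(v)^Tb .$$ Then $$\operatorname{prox}_{\Omega_w}(v)=a\odot\operatorname{sign}(v).$$
   Context: For $x\in\mathbb{R}^n$, $\grave{x}$ denotes $x$ with entries sorted in non-increasing order of magnitude (ties broken by an arbitrary fixed rule), and $\Omega_w(x)=\sum_{i=1}^n w_i|\grave{x}_i|$. The proximity operator is $\operatorname{prox}_{\Omega_w}(v)=\arg\min_{x\in\mathbb{R}^n}\bigl(\Omega_w(x)+\tfrac12\|x-v\|_2^2\bigr)$. $|\cdot|$ and $\operatorname{sign}$ act componentwise on vectors, and $\odot$ is the componentwise product. Groups: let $b^\circ=\arg\min_{x\in\mathbb{R}_+^n}\bigl(\Omega_w(x)+\tfrac12\|x-|\grave{v}|\|_2^2\bigr)$, where $\mathbb{R}_+^n$ is the set of vectors with non-negative entries. The entries of $b^\circ$ are non-increasing, and the groups $\{s_j,\dots,t_j\}$, $j=1,\dots,l$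 (with $s_1=1$, $t_l=n$, $s_{j+1}=t_j+1$) are the maximal runs of consecutive indices on which $b^\circ$ is constant. With $\vartheta_j=t_j-s_j+1$, set $\bar v_j=\frac1{\vartheta_j}\sum_{i=s_j}^{t_j}|\grave{v}_i|$ and $\bar w_j=\frac1{\vartheta_j}\sum_{i=s_j}^{t_j}w_i$. The vectors $\bar{\bar v},\bar{\bar w}\in\mathbb{R}^n$ have entries $\bar{\bar v}_i=\bar v_j$ and $\bar{\bar w}_i=\bar w_j$ for all $i\in\{s_j,\dots,t_j\}$. *)

(* Defs.v *)
(* Vectors of R^n are column vectors. *)
From mathcomp Require Import all_boot all_order all_algebra.
From mathcomp Require Import all_classical all_reals.

Set Implicit Arguments.
Unset Strict Implicit.
Unset Printing Implicit Defensive.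

Import Order.TTheory GRing.Theory Num.Theory.
Local Open Scope classical_set_scope.
Local Open Scope ring_scope.

(* The full set of minimizers: [argmin C f = [set x]] says that the minimum
   is attained at [x] and nowhere else. *)
Definition argmin (T : Type) (R : realType) (C : set T) (f : T -> R) : set T :=
  [set x | C x /\ forall y, C y -> f x <= f y].

Section Prox.
Variables (R : realType) (n : nat).
Implicit Types (w x y u v : 'cV[R]_n) (A : {set 'I_n}) (i j k : 'I_n).

Definition absv x : 'cV[R]_n := map_mx (fun a => `|a|) x.
Definition signv x : 'cV[R]_n := map_mx Num.sg x.
Definition hadamard x y : 'cV[R]_n := map2_mx *%R x y.
Definition posv x : 'cV[R]_n := map_mx (fun a => Num.max a 0) x.
Definition sqnorm2 x : R := \sum_i x i 0 ^+ 2.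

Definition nonincreasing x : Prop :=
  forall i j, j = i.+1 :> nat -> x j 0 <= x i 0.

(* Since [sort] is stable, entries of equal magnitude keep their order. *)
Definition sortmag x : 'cV[R]_n :=
  \col_(i < n) nth 0 (sort (fun a b : R => `|b| <= `|a|)
                           [seq x k 0 | k <- enum 'I_n]) i.

Definition Omega w x : R := \sum_i w i 0 * `|sortmag x i 0|.

Definition prox_obj w v x : R := Omega w x + 2^-1 * sqnorm2 (x - v).

Definition prox w v : set 'cV[R]_n := argmin setT (prox_obj w v).

(* To be used with [u] the sorted vector of magnitudes of v.  For nonincreasing
   nonnegative [w] the objective is continuous, coercive and strictly convex, so
   the minimizer exists and is unique, and the default 0 plays no role. *)
Definition bcirc w u : 'cV[R]_n :=
  xget 0 (argmin [set x : 'cV[R]_n | forall i, 0 <= x i 0] (prox_obj w u)).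

Definition is_run x A : bool :=
  [forall i in A, forall j in A,
     (x i 0 == x j 0) && [forall k : 'I_n, (i <= k <= j)%N ==> (k \in A)]].

(* The maximal runs are nonempty when n > 0, and they partition 'I_n. *)
Definition groups w u : {set {set 'I_n}} :=
  [set A : {set 'I_n} | finset.maxset (is_run (bcirc w u)) A]%SET.

Definition group_of w u i : {set 'I_n} := finset.pblock (groups w u) i.

(* The vector whose i-th entry is the mean of [x] over the group of i. *)
Definition group_avg w u x : 'cV[R]_n :=
  \col_i ((\sum_(k in group_of w u i) x k 0) / #|group_of w u i|%:R).

End Prox.

(* Main.v *)
(* Let u be the sorted vector of magnitudes of v and let x be the projection of
   u - w onto the cone of nonincreasing nonnegative vectors.  By the
   rearrangement inequality the objective at y is at least
   sum_i w_i t_i + |t - u|^2 / 2, where t is the vector of sorted magnitudes of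
   y; this is minimal at t = x, and the value is attained by permuting x back and
   restoring the signs of v.  Minimizers are unique by strict convexity, so x is
   also b°.  Finally the residual (u - w) - x is orthogonal to phi(x) for every
   phi with phi(0) = 0: indicators of level sets as phi show that a positive
   value of x is the mean of u - w over its group, while the mean over the zero
   group is nonpositive. *)
Require Import Defs.
From mathcomp Require Import all_boot all_order all_algebra.
From mathcomp Require Import fingroup perm all_classical all_reals.
From mathcomp Require Import ring lra zify.

Set Implicit Arguments.
Unset Strict Implicit.
Unset Printing Implicit Defensive.

Import Order.TTheory GRing.Theory Num.Theory.
Local Open Scope classical_set_scope.
Local Open Scope ring_scope.

(** * Summation by parts against nonincreasing vectors *)

Lemma abel_sum (R : comPzRingType) (n : nat) (d y : nat -> R) :
  \sum_(i < n) d i * y i =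
  \sum_(k < n) (\sum_(i < k.+1) d i) * (y k - y k.+1) + (\sum_(i < n) d i) * y n.
Proof.
elim: n => [|n IH]; first by rewrite !big_ord0 mul0r addr0.
rewrite big_ord_recr /= IH [in RHS]big_ord_recr /= [in RHS]big_ord_recr /=.
ring.
Qed.

Section SortedProx.
Variable R : realType.

(** Extension by zero gives meaning to [y k.+1] at the last index and kills the boundary term of
    [abel_sum]. *)
Definition ext0 n (x : 'cV[R]_n) (k : nat) : R :=
  if insub k is Some i then x i 0 else 0.

Lemma ext0E n (x : 'cV[R]_n) (i : 'I_n) : ext0 x i = x i 0.
Proof. by rewrite /ext0 valK. Qed.

Lemma ext0_ge n (x : 'cV[R]_n) k : (n <= k)%N -> ext0 x k = 0.
Proof. by move=> h; rewrite /ext0 insubF // ltnNge h. Qed.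

Lemma ext0_decr n (x : 'cV[R]_n) k :
  nonincreasing x -> (forall i, 0 <= x i 0) -> ext0 x k.+1 <= ext0 x k.
Proof.
move=> hx x0; have [h1|h1] := ltnP k.+1 n.
  have h := ltnW h1.
  by rewrite (ext0E x (Ordinal h1)) (ext0E x (Ordinal h)) hx.
rewrite (ext0_ge x h1); have [h|h] := ltnP k n; last by rewrite ext0_ge.
by rewrite (ext0E x (Ordinal h)).
Qed.

Lemma nonincreasing_le n (x : 'cV[R]_n) (i j : 'I_n) :
  nonincreasing x -> (i <= j)%N -> x j 0 <= x i 0.
Proof.
move=> hx; case: j => j; elim: j => [|j IH] hj /= hij.
  by rewrite (_ : Ordinal hj = i) //; apply/val_inj => /=; lia.
move: hij; rewrite leq_eqVlt => /orP[/eqP e|hij].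
  by rewrite (_ : Ordinal hj = i) //; apply/val_inj.
by apply: le_trans (IH (ltnW hj) hij); apply: hx.
Qed.

(** After summation by parts each term is a nonpositive prefix sum times a nonnegative decrement. *)
Lemma prefix_le0_sum n (d : nat -> R) (y : 'cV[R]_n) :
  (forall k, (k <= n)%N -> \sum_(i < k) d i <= 0) ->
  nonincreasing y -> (forall i, 0 <= y i 0) ->
  \sum_(i < n) d i * y i 0 <= 0.
Proof.
move=> hd hy y0; under eq_bigr => i _ do rewrite -ext0E.
rewrite (abel_sum n d (ext0 y)) (ext0_ge y (leqnn n)) mulr0 addr0.
apply: sumr_le0 => k _; apply: mulr_le0_ge0; first exact/hd/ltn_ord.
by rewrite subr_ge0 ext0_decr.
Qed.

(** * Rearrangement inequality and sorting by magnitude *)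

Lemma prefix_perm_le n (y : 'cV[R]_n) (s : 'S_n) k :
  nonincreasing y -> (k <= n)%N ->
  \sum_(i < k) ext0 (row_perm s y) i <= \sum_(i < k) ext0 y i.
Proof.
move=> hy; case: k => [|k] hk; first by rewrite !big_ord0.
(* Compare with the excess over the threshold [t], the [k.+1]-st largest value. *)
set t := y (Ordinal hk) 0.
pose g (a : R) := Num.max (a - t) 0.
have le_g a : a - t <= g a by rewrite le_max lexx.
have g0 a : 0 <= g a by rewrite le_max lexx orbT.
have big (F : nat -> R) : \sum_(i < k.+1) F i = \sum_(i < n | (i < k.+1)%N) F i.
  by rewrite (big_ord_widen n).
rewrite -subr_le0 -sumrB.
rewrite (big (fun i => ext0 (row_perm s y) i - ext0 y i)).
(* Over all of ['I_n] the excesses cancel, since [s] permutes them. Beyond position [k] those of [y]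
   vanish; up to [k] they equal [y i 0 - t]. *)
apply: (@le_trans _ _ (\sum_(i < n) (g (y (s i) 0) - g (y i 0)))); last first.
  by rewrite sumrB [X in _ - X](reindex_inj (@perm_inj _ s)) subrr.
rewrite [leRHS](bigID (fun i : 'I_n => (i < k.+1)%N)) /=.
apply: ler_wpDr; last apply: ler_sum => i hi.
  apply: sumr_ge0 => i; rewrite -leqNgt => hi.
  have -> : g (y i 0) = 0; last by rewrite subr0.
  by apply/max_idPr; rewrite subr_le0; apply: nonincreasing_le => //=; lia.
rewrite !ext0E mxE; have -> : g (y i 0) = y i 0 - t.
  by apply/max_idPl; rewrite subr_ge0; apply: nonincreasing_le => //=; lia.
by have := le_g (y (s i) 0); lra.
Qed.

Lemma rearrangement n (c y : 'cV[R]_n) (s : 'S_n) :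
  nonincreasing c -> (forall i, 0 <= c i 0) -> nonincreasing y ->
  \sum_i c i 0 * y (s i) 0 <= \sum_i c i 0 * y i 0.
Proof.
move=> hc c0 hy; rewrite -subr_le0 -sumrB.
rewrite (eq_bigr (fun i : 'I_n => (ext0 (row_perm s y) i - ext0 y i) * c i 0)).
  apply: (@prefix_le0_sum n (fun i => ext0 (row_perm s y) i - ext0 y i)) => // k hk.
  by rewrite sumrB subr_le0 prefix_perm_le.
by move=> i _; rewrite !ext0E mxE; ring.
Qed.

Lemma sortmag_perm n (x : 'cV[R]_n) :
  exists s : 'S_n, forall i, sortmag x i 0 = x (s i) 0.
Proof.
set r := fun a b : R => `|b| <= `|a|.
have /tuple_permP[s hs] :
    perm_eq (sort r [seq x k 0 | k <- enum 'I_n]) [tuple x k 0 | k < n].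
  by rewrite perm_sort.
by exists s => i; rewrite mxE hs -tnth_nth !tnth_mktuple.
Qed.

Lemma sortmag_decr n (x : 'cV[R]_n) : nonincreasing (absv (sortmag x)).
Proof.
move=> i j ij; rewrite !mxE ij; set r := fun a b : R => `|b| <= `|a|.
have /(sortedP (0 : R)) : sorted r (sort r [seq x k 0 | k <- enum 'I_n]).
  by apply: sort_sorted => a b; apply: le_total.
by apply; rewrite size_sort size_map size_enum_ord -ij.
Qed.

(** For such weights, [Omega] is thus a maximum of weighted l1 norms over all orderings, which makes
    it convex. *)
Lemma sortmag_max n (c x : 'cV[R]_n) (s : 'S_n) :
  nonincreasing c -> (forall i, 0 <= c i 0) ->
  \sum_i c i 0 * `|x (s i) 0| <= \sum_i c i 0 * `|sortmag x i 0|.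
Proof.
move=> hc c0; have [t ht] := sortmag_perm x.
have := rearrangement (s * t^-1)%g hc c0 (sortmag_decr x).
under eq_bigr => i _ do rewrite mxE ht permM permKV.
by under [leRHS]eq_bigr => i _ do rewrite mxE.
Qed.

(** * Projection onto the cone of nonincreasing nonnegative vectors *)

Lemma sum_ord_cat (F : nat -> R) m n :
  \sum_(i < m + n) F i = \sum_(i < m) F i + \sum_(i < n) F (m + i)%N.
Proof. by rewrite big_split_ord. Qed.

(* The first block is an initial segment with the largest mean [c] of [z], and the
   rest is treated recursively, until the largest mean is nonpositive.  The last
   clause ensures that the next block does not exceed [c]. *)
Lemma greedy_averages n (z : nat -> R) : exists x : nat -> R,
  [/\ forall i, x i.+1 <= x i,
      forall i, (n <= i)%N -> x i = 0,
      forall k, (k <= n)%N -> \sum_(i < k) (z i - x i) <= 0,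
      forall k, (k < n)%N -> x k.+1 < x k -> \sum_(i < k.+1) (z i - x i) = 0 &
      forall c, 0 <= c ->
        (forall k, (k < n)%N -> \sum_(i < k.+1) z i <= c * k.+1%:R) -> x 0%N <= c].
Proof.
elim/ltn_ind: n z => -[|n] IH z.
  exists (fun=> 0); split => // k.
  by rewrite leqn0 => /eqP->; rewrite big_ord0.
pose mean (k : 'I_n.+1) := (\sum_(i < k.+1) z i) / k.+1%:R.
have [k _ hk] := @arg_maxP _ _ _ ord0 predT mean isT.
set c := mean k in hk.
have sum_le m : (m <= n.+1)%N -> \sum_(i < m) z i <= c * m%:R.
  case: m => [|m] hm; first by rewrite big_ord0 mulr0.
  by rewrite -ler_pdivrMr ?ltr0Sn //; exact: (hk (Ordinal hm)).
have sum_k : \sum_(i < k.+1) z i = c * k.+1%:R.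
  by rewrite /c /mean divfK // pnatr_eq0.
have [c0|c0] := leP c 0.
  exists (fun=> 0); split => // m hm; last by rewrite ltxx.
  under eq_bigr => i _ do rewrite subr0.
  by apply: le_trans (sum_le _ hm) _; rewrite mulr_le0_ge0.
have hn : (n.+1 - k.+1 < n.+1)%N by lia.
have [x [xd x0 xS xE xc]] := IH _ hn (fun i => z (k.+1 + i)%N).
have xc0 : x 0%N <= c.
  apply: xc => [|j hj]; first exact: ltW.
  (* A longer prefix also has mean at most [c]; removing the first block, of mean exactly [c],
     leaves the same bound for the rest. *)
  have := @sum_le (k.+1 + j.+1)%N;
  rewrite (sum_ord_cat z k.+1) sum_k natrD mulrDr lerD2l.
  by apply; have := ltn_ord k; lia.
pose X i := if (i < k.+1)%N then c else x (i - k.+1)%N.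
have X_head m : (m <= k.+1)%N -> \sum_(i < m) (z i - X i) = \sum_(i < m) z i - c * m%:R.
  move=> hm; rewrite sumrB; congr (_ - _).
  rewrite (eq_bigr (fun=> c)) ?sumr_const ?card_ord ?mulr_natr // => i _.
  by rewrite /X (leq_trans (ltn_ord i) hm).
have X_tail m : \sum_(i < k.+1 + m) (z i - X i) = \sum_(i < m) (z (k.+1 + i)%N - x i).
  rewrite (sum_ord_cat (fun i => z i - X i) k.+1) X_head // sum_k subrr add0r.
  apply: eq_bigr => i _; by rewrite /X ltnNge leq_addr /= addKn.
exists X; split => [i|i hi|m hm|m hm|d d0 hd].
- rewrite /X; case: (ltngtP i k) => ik.
  + by rewrite !ifT //; lia.
  + by rewrite !ifF ?subSn //; lia.
  + by rewrite ik ltnn ltnSn subnn.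
- by rewrite /X ltnNge (leq_trans _ hi) //= x0 // leq_sub2r.
- have [hk'|hk'] := leqP m k.+1; first by rewrite X_head // subr_le0 sum_le.
  rewrite -(subnKC (ltnW hk')) X_tail; apply: xS; exact: leq_sub2r.
- have [mk|mk|mk] := ltngtP m k.
  + by rewrite /X !ifT ?ltxx //; lia.
  + rewrite /X !ifF ?subSn => [hX|||]; try lia.
    rewrite -(subnKC (leqW mk)) X_tail subSn //; apply: xE => //; lia.
  + by rewrite mk X_head // sum_k subrr.
- rewrite /X /=; have := hd k (ltn_ord k).
  by rewrite sum_k ler_pM2r // ltr0Sn.
Qed.

(* Optimality conditions for [x] to be the projection of [z] onto the cone of
   nonincreasing nonnegative vectors; [phi := id] gives complementarity. *)
Definition is_cone_proj n (z x : 'cV[R]_n) : Prop :=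
  [/\ nonincreasing x, forall i, 0 <= x i 0,
      forall y : 'cV[R]_n, nonincreasing y -> (forall i, 0 <= y i 0) ->
        \sum_i (z i 0 - x i 0) * y i 0 <= 0 &
      forall phi : R -> R, phi 0 = 0 ->
        \sum_i (z i 0 - x i 0) * phi (x i 0) = 0].

Lemma cone_proj_exists n (z : 'cV[R]_n) : exists x, is_cone_proj z x.
Proof.
have [x [xd x0 xS xE _]] := greedy_averages n (ext0 z).
have dE (i : 'I_n) : z i 0 - (\col_(j < n) x j) i 0 = ext0 z i - x i.
  by rewrite ext0E mxE.
exists (\col_i x i); split => [i j ij|i|y hy y0|phi phi0].
- by rewrite !mxE ij.
- have xle m : x (i + m)%N <= x i.
    by elim: m => [|m IH]; rewrite ?addn0 // addnS (le_trans (xd _)).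
  by rewrite mxE -(x0 (i + n)%N) ?leq_addl.
- under eq_bigr => i _ do rewrite dE.
  exact: (@prefix_le0_sum n (fun i => ext0 z i - x i)).
- under eq_bigr => i _ do rewrite dE mxE.
  (* In each Abel term, either [x] does not drop and [phi \o x] has increment zero, or [x] drops and
     the prefix sum of the residual vanishes. *)
  rewrite (abel_sum n (fun i => ext0 z i - x i) (phi \o x)) /= (x0 n) // phi0 mulr0.
  rewrite addr0; apply: big1 => k _.
  have := xd k; rewrite le_eqVlt => /orP[/eqP->|/xE->]; rewrite ?ltn_ord //.
    by rewrite subrr mulr0.
  by rewrite mul0r.
Qed.

(** * Strong convexity and the minimizers of [prox_obj] *)

Lemma prox_obj_midpoint n (w v x y : 'cV[R]_n) :
  nonincreasing w -> (forall i, 0 <= w i 0) ->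
  prox_obj w v (2^-1 *: (x + y)) + 8^-1 * sqnorm2 (x - y) <=
  2^-1 * (prox_obj w v x + prox_obj w v y).
Proof.
move=> hw w0; rewrite /prox_obj.
(* The ordering that sorts the midpoint is one candidate for both [x] and [y] in [sortmag_max]. *)
have hO : Omega w (2^-1 *: (x + y)) <= 2^-1 * (Omega w x + Omega w y).
  have [s hs] := sortmag_perm (2^-1 *: (x + y)).
  have h2 : 0 <= 2^-1 :> R by rewrite invr_ge0.
  apply: le_trans (ler_wpM2l h2 (lerD (sortmag_max x s hw w0) (sortmag_max y s hw w0))).
  rewrite -big_split mulr_sumr /=; apply: ler_sum => i _; rewrite hs !mxE.
  rewrite normrM ger0_norm // mulrCA ler_wpM2l // -mulrDr ler_wpM2l //.
  exact: ler_normD.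
(* Parallelogram identity; its [4^-1] times the factor [2^-1] of the objective gives [8^-1]. *)
suff -> : sqnorm2 (2^-1 *: (x + y) - v) =
    2^-1 * (sqnorm2 (x - v) + sqnorm2 (y - v)) - 4^-1 * sqnorm2 (x - y) by lra.
rewrite /sqnorm2 -big_split !mulr_sumr -sumrB; apply: eq_bigr => i _.
by rewrite /= !mxE; field.
Qed.

(** Minimality over the whole space with an arbitrary [C] serves both [prox] and the constrained
    problem of [bcirc]. The midpoint with a second minimizer would be strictly better. *)
Lemma argmin_prox_obj n (w v x : 'cV[R]_n) (C : set 'cV[R]_n) :
  nonincreasing w -> (forall i, 0 <= w i 0) ->
  C x -> (forall y, prox_obj w v x <= prox_obj w v y) ->
  argmin C (prox_obj w v) = [set x].
Proof.
move=> hw w0 Cx xmin; apply/seteqP; split => [y /= [_ /(_ x Cx) yx]|_ -> //=].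
have := prox_obj_midpoint v x y hw w0; have := xmin (2^-1 *: (x + y)) => h1 h2.
have : sqnorm2 (x - y) == 0.
  by rewrite eq_le [0 <= _]sumr_ge0 ?andbT => [|i _]; [lra | rewrite sqr_ge0].
rewrite psumr_eq0 => [/allP h|i _]; last exact: sqr_ge0.
apply/colP => i; have := h i (mem_index_enum i).
by rewrite sqrf_eq0 !mxE subr_eq0 => /eqP.
Qed.

(** Passing to sorted magnitudes preserves both norms and can only increase the inner product. *)
Lemma sqnorm2_sort_le n (v y : 'cV[R]_n) (s : 'S_n) :
  nonincreasing (absv (row_perm s v)) ->
  sqnorm2 (absv (sortmag y) - absv (row_perm s v)) <= sqnorm2 (y - v).
Proof.
move=> hs; have [t ht] := sortmag_perm y.
have hyv : \sum_i y i 0 * v i 0 <= \sum_i `|v (s i) 0| * `|sortmag y i 0|.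
  have u0 i : 0 <= absv (row_perm s v) i 0 by rewrite mxE.
  have uE i : absv (row_perm s v) i 0 = `|v (s i) 0| by rewrite !mxE.
  have := sortmag_max y s hs u0.
  under eq_bigr => i _ do rewrite uE.
  under [leRHS]eq_bigr => i _ do rewrite uE.
  apply: le_trans.
  rewrite (reindex_inj (@perm_inj _ s)) /=; apply: ler_sum => i _.
  by rewrite -normrM mulrC ler_norm.
have hy : \sum_i `|sortmag y i 0| ^+ 2 = \sum_i y i 0 ^+ 2.
  rewrite [RHS](reindex_inj (@perm_inj _ t)); apply: eq_bigr => i _.
  by rewrite ht real_normK ?num_real.
have hv : \sum_i `|v (s i) 0| ^+ 2 = \sum_i v i 0 ^+ 2.
  rewrite [RHS](reindex_inj (@perm_inj _ s)); apply: eq_bigr => i _.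
  by rewrite real_normK ?num_real.
have sqB (a b : 'I_n -> R) : \sum_i (a i - b i) ^+ 2 =
    \sum_i a i ^+ 2 + \sum_i b i ^+ 2 - 2 * \sum_i b i * a i.
  by rewrite mulr_sumr -big_split -sumrB; apply: eq_bigr => i _ /=; ring.
have TE i : (absv (sortmag y) - absv (row_perm s v)) i 0 =
    `|sortmag y i 0| - `|v (s i) 0| by rewrite !mxE.
have yvE i : (y - v) i 0 = y i 0 - v i 0 by rewrite !mxE.
rewrite /sqnorm2 (eq_bigr _ (fun i _ => congr1 (fun a => a ^+ 2) (TE i))).
rewrite [leRHS](eq_bigr _ (fun i _ => congr1 (fun a => a ^+ 2) (yvE i))).
rewrite !sqB hy hv lerD2l lerN2 ler_pM2l //.
by under eq_bigr => i _ do rewrite mulrC.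
Qed.

(** Inequalities on [y] admit a zero entry wherever [v] vanishes. The case [s = 1], [y = x] yields
    [bcirc]; the sorting permutation of [v] yields [prox]. *)
Lemma cone_proj_argmin n (w v x y : 'cV[R]_n) (s : 'S_n) (C : set 'cV[R]_n) :
  let u := absv (row_perm s v) in
  nonincreasing w -> (forall i, 0 <= w i 0) -> nonincreasing u ->
  is_cone_proj (u - w) x ->
  (forall i, `|y (s i) 0| <= x i 0) ->
  (forall i, (y (s i) 0 - v (s i) 0) ^+ 2 <= (x i 0 - u i 0) ^+ 2) ->
  C y -> argmin C (prox_obj w v) = [set y].
Proof.
move=> u hw w0 hu [xd x0 xK xphi] yx yv Cy; apply: argmin_prox_obj => // t.
apply: (@le_trans _ _ (\sum_i (w i 0 * x i 0 + 2^-1 * (x i 0 - u i 0) ^+ 2))).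
  rewrite big_split -mulr_sumr /=; apply: lerD.
    have [r hr] := sortmag_perm y.
    apply: le_trans (rearrangement (r * s^-1)%g hw w0 xd); apply: ler_sum => i _.
    by rewrite hr permM ler_wpM2l // -{1}(permKV s (r i)).
  rewrite ler_pM2l ?invr_gt0 // /sqnorm2 (reindex_inj (@perm_inj _ s)) /=.
  by apply: ler_sum => i _; rewrite !mxE; have := yv i; rewrite !mxE.
set T := absv (sortmag t).
apply: (@le_trans _ _ (\sum_i w i 0 * T i 0 + 2^-1 * sqnorm2 (T - u))); last first.
  rewrite lerD ?ler_pM2l ?invr_gt0 ?sqnorm2_sort_le //.
  by apply: ler_sum => i _; rewrite mxE.
have T0 i : 0 <= T i 0 by rewrite mxE.
have := xK T (sortmag_decr t) T0; have := xphi id erefl.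
rewrite /= /sqnorm2 mulr_sumr -big_split /= => h1 h2.
have h3 : 0 <= 2^-1 * \sum_i (T i 0 - x i 0) ^+ 2.
  by rewrite mulr_ge0 ?invr_ge0 ?sumr_ge0 // => i _; rewrite sqr_ge0.
rewrite -subr_ge0 -sumrB.
(* Of the three terms on the right, the first is nonnegative, the subtracted one is nonpositive as
   [T] lies in the cone, and the last is zero by complementarity. *)
suff -> : \sum_i (w i 0 * T i 0 + 2^-1 * (T - u) i 0 ^+ 2 -
    (w i 0 * x i 0 + 2^-1 * (x i 0 - u i 0) ^+ 2)) =
    2^-1 * \sum_i (T i 0 - x i 0) ^+ 2 - \sum_i ((u - w) i 0 - x i 0) * T i 0
    + \sum_i ((u - w) i 0 - x i 0) * x i 0 by lra.
rewrite mulr_sumr -sumrB -big_split /=; apply: eq_bigr => i _.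
have B (a b : 'cV[R]_n) : (a - b) i 0 = a i 0 - b i 0 by rewrite !mxE.
by rewrite !B; field.
Qed.

Lemma bcircE n (w u x : 'cV[R]_n) :
  nonincreasing w -> (forall i, 0 <= w i 0) ->
  nonincreasing u -> (forall i, 0 <= u i 0) ->
  is_cone_proj (u - w) x -> bcirc w u = x.
Proof.
move=> hw w0 hu u0 hx.
have uE : absv (row_perm 1%g u) = u.
  by apply/colP => i; rewrite !mxE perm1 ger0_norm.
rewrite /bcirc (@cone_proj_argmin n w u x x 1%g) ?uE // => [|i|i|].
- exact: (@xget_unique _ _ [set x] x).
- by rewrite perm1 ger0_norm //; case: hx.
- by rewrite perm1.
- by case: hx.
Qed.

(** * Groups as level sets and their averages *)

Lemma group_ofE n (w u : 'cV[R]_n) (i : 'I_n) :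
  nonincreasing (bcirc w u) ->
  Defs.group_of w u i = [set k | bcirc w u k 0 == bcirc w u i 0]%SET.
Proof.
set x := bcirc w u => hx.
(* Monotonicity makes each level set contiguous, hence a run, and a run lies in the level set of any
   of its members; so the maximal runs are the level sets. *)
pose L (j : 'I_n) := [set k | x k 0 == x j 0]%SET.
have run_sub A (j : 'I_n) : is_run x A -> j \in A -> A \subset L j.
  move=> /forallP run jA; apply/fintype.subsetP => k kA; rewrite inE.
  by have /implyP/(_ kA)/forallP/(_ j)/implyP/(_ jA)/andP[] := run k.
have L_run j : is_run x (L j).
  apply/forallP => a; apply/implyP; rewrite inE => /eqP xa.
  apply/forallP => b; apply/implyP; rewrite inE => /eqP xb.
  rewrite xa xb eqxx /=; apply/forallP => k; apply/implyP => /andP[ak kb].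
  by rewrite inE eq_le -{1}xa -xb !nonincreasing_le.
have L_max A (j : 'I_n) : A \in groups w u -> j \in A -> A = L j.
  rewrite inE => /finset.maxsetP[runA maxA] jA.
  by apply/esym/maxA; rewrite ?L_run // run_sub.
rewrite /Defs.group_of -/(L i); apply: def_pblock; last by rewrite inE.
  apply/finset.trivIsetP => A B gA gB; apply: contraR => /pred0Pn[j /andP[/= jA jB]].
  by rewrite (L_max _ _ gA jA) (L_max _ _ gB jB).
rewrite inE; apply/finset.maxsetP; split => // B runB /fintype.subsetP LB.
have iB : i \in B by apply: LB; rewrite inE.
by apply/eqP; rewrite finset.eqEsubset run_sub //=; apply/fintype.subsetP.
Qed.

Lemma posv_group_avg n (w u : 'cV[R]_n) :
  is_cone_proj (u - w) (bcirc w u) ->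
  posv (group_avg w u u - group_avg w u w) = bcirc w u.
Proof.
set x := bcirc w u => -[xd x0 xK xphi]; apply/colP => i; rewrite !mxE group_ofE //.
set L := [set _ | _]%SET; rewrite -mulrBl -sumrB.
have L_gt0 : 0 < #|L|%:R :> R.
  by rewrite ltr0n card_gt0; apply/set0Pn; exists i; rewrite inE.
have -> : \sum_(k in L) (u k 0 - w k 0) =
    \sum_(k in L) ((u - w) k 0 - x k 0) + x i 0 * #|L|%:R.
  rewrite mulr_natr -sumr_const -big_split /=; apply: eq_bigr => k.
  by rewrite inE => /eqP xk; rewrite !mxE xk; ring.
rewrite mulrDl mulfK ?gt_eqF //.
have sum_sel (p : pred R) : \sum_(k | p (x k 0)) ((u - w) k 0 - x k 0) =
    \sum_k ((u - w) k 0 - x k 0) * (p (x k 0))%:R.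
  by rewrite big_mkcond; apply: eq_bigr => k _; case: (p _); rewrite ?mulr1 ?mulr0.
have -> : \sum_(k in L) ((u - w) k 0 - x k 0) =
    \sum_(k | x k 0 == x i 0) ((u - w) k 0 - x k 0).
  by apply: eq_bigl => k; rewrite inE.
(* At a positive level, the indicator of that level vanishes at 0 and is a valid [phi]. *)
have := x0 i; rewrite le_eqVlt => /orP[/eqP xi0|xi_gt0]; last first.
  rewrite (sum_sel (pred1 (x i 0))) (xphi (fun a => (pred1 (x i 0) a)%:R)).
    by rewrite mul0r add0r; apply/max_idPl.
  by rewrite /= lt_eqF.
rewrite -xi0 addr0; apply/max_idPr; rewrite pmulr_lle0 ?invr_gt0 //.
(* Pairing with the constant vector 1 shows that the total residual is nonpositive; the nonzero
   levels contribute zero to it, which leaves the zero group. *)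
have one_d : nonincreasing (const_mx 1 : 'cV[R]_n) by move=> *; rewrite !mxE.
have one0 k : 0 <= (const_mx 1 : 'cV[R]_n) k 0 by rewrite mxE.
apply: le_trans (xK _ one_d one0).
under [leRHS]eq_bigr => k _ do rewrite [const_mx _ _ _]mxE mulr1.
rewrite [leRHS](bigID (fun k => x k 0 == 0)) /= lerDl.
by rewrite (sum_sel (predC1 0)) (xphi (fun a => (predC1 0 a)%:R)) //= eqxx.
Qed.

End SortedProx.

Theorem theorem3 (R : realType) (n : nat) (w v : 'cV[R]_n) (P : 'M[R]_n)
    (hn : (1 <= n)%N)
    (hw : nonincreasing w) (hw0 : forall i, 0 <= w i 0)
    (hP : is_perm_mx P) (hPv : nonincreasing (absv (P *m v))) :
  let u := absv (P *m v) in
  let b := posv (group_avg w u u - group_avg w u w) in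
  let a := P^T *m b in
  prox w v = [set hadamard a (signv v)].
Proof.
move=> u b a; have /is_perm_mxP[s Ps] := hP.
have uE : u = absv (row_perm s v) by rewrite row_permE -Ps.
have u0 i : 0 <= u i 0 by rewrite mxE.
have [x hx] := cone_proj_exists (u - w).
have bE : b = x by rewrite /b posv_group_avg ?(bcircE hw hw0 hPv u0 hx).
have aE i : a (s i) 0 = x i 0.
  by rewrite /a bE Ps tr_perm_mx -row_permE mxE permK.
have x0 i : 0 <= x i 0 by case: hx.
have yE i : hadamard a (signv v) (s i) 0 = x i 0 * Num.sg (v (s i) 0).
  by rewrite -aE [LHS]mxE; congr (_ * _); apply: mxE.
move: hPv; rewrite -/u => hu; rewrite uE in hx hu.
apply: (cone_proj_argmin hw hw0 hu hx) => // i; rewrite yE.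
  by rewrite normrM (ger0_norm (x0 i)) normr_sg ler_piMr // lern1 leq_b1.
(* Where [v] vanishes so does the candidate; elsewhere the sign factors out and equality holds. *)
rewrite !mxE; have [->|v0] := eqVneq (v (s i) 0) 0.
  by rewrite sgr0 mulr0 normr0 !subr0 expr0n sqr_ge0.
by rewrite [X in _ * _ - X]numEsg mulrC -mulrBr exprMn sqr_sg v0 mul1r.
Qed.
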